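(* Let $d\ge 1$ and let $K=K_1\times K_2\times\dots\times K_d\times K_{d+1}$, where $K_1,\dots,K_d$ are nonmetrizable compact Hausdorff spaces and $K_{d+1}$ is an infinite compact Hausdorff space. Then $\text{free-dim}(K)\ge d+1$.
   Context: For a compact Hausdorff space $K$, $\mathrm{FCC}(K)$ denotes the family of all finite covers of $K$ by closed subsets. For finite covers $\mathcal C_1,\mathcal C_2$ of $K$ write $\mathcal C_1\prec\mathcal C_2$ ($\mathcal C_1$ refines $\mathcal C_2$) if every $C_1\in\mathcal C_1$ is contained in some $C_2\in\mathcal C_2$. A family $\mathfrak C\subseteq \mathrm{FCC}(K)$ is topologically cofinal if for every open cover $\mathcal U$ of $K$ there is $\mathcal C\in\mathfrak C$ with $\mathcal C\prec\mathcal U$ (every member of $\mathcal C$ is contained in a member of $\mathcal U$). For $d\in\mathbb N=\{0,1,2,\dots\}$, write $\text{free-dim}(K)\le d$ if there are a topologically cofinal family $\mathfrak C\subseteq\mathrm{FCC}(K)$, a constant $M>0$ and a function $\chi:\mathfrak C\to\mathbb N$ such that for every $k\ge 1$, any $\mathcal C_1,\dots,\mathcal C_k\in\mathfrak C$ have a joint refinement $\mathcal C\in\mathrm{FCC}(K)$ (i.e. $\mathcal C\prec\mathcal C_i$ for all $i\le k$) with $|\mathcal C|\le M\big(\chi(\mathcal C_1)+\dots+\chi(\mathcal C_k)\big)^d$ (with $0^0=1$). Write $\text{free-dim}(K)\ge d+1$ if $\text{free-dim}(K)\le d$ does not hold. *)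

(* Defs.v *)
From mathcomp Require Import all_boot all_order all_algebra finmap.
From mathcomp Require Import all_classical all_reals all_analysis.

Set Implicit Arguments.
Unset Strict Implicit.
Unset Printing Implicit Defensive.

Import Order.TTheory GRing.Theory Num.Theory.

Local Open Scope classical_set_scope.
Local Open Scope ring_scope.

Definition metrizable (R : realType) (T : topologicalType) : Prop :=
  exists (X : metricType R) (f : T -> X) (g : X -> T),
    [/\ cancel f g, cancel g f, continuous f & continuous g].

Definition FCC (T : topologicalType) : set (set (set T)) :=
  [set C | [/\ finite_set C, (forall A, C A -> closed A)
             & \bigcup_(A in C) A = [set: T]]].

Definition refines (T : Type) (C1 C2 : set (set T)) : Prop :=
  forall A, C1 A -> exists2 B, C2 B & A `<=` B.

Definition open_cover (T : topologicalType) (U : set (set T)) : Prop :=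
  (forall A, U A -> open A) /\ \bigcup_(A in U) A = [set: T].

Definition topologically_cofinal (T : topologicalType)
    (F : set (set (set T))) : Prop :=
  forall U, open_cover U -> exists2 C, F C & refines C U.

(* The function chi is only ever evaluated on members of F, so its values
   outside F are irrelevant.  The power is taken in nat, where 0 ^ 0 = 1. *)
Definition free_dim_le (R : realType) (T : topologicalType) (d : nat) : Prop :=
  exists (F : set (set (set T))) (M : R) (chi : set (set T) -> nat),
    [/\ F `<=` @FCC T, topologically_cofinal F, 0 < M
      & forall (k : nat) (C : 'I_k -> set (set T)),
          (1 <= k)%N -> (forall i, F (C i)) ->
          exists D : set (set T),
            [/\ FCC D, (forall i, refines D (C i))
              & (#|` fset_set D|)%:R <= M * ((\sum_(i < k) chi (C i)) ^ d)%N%:R]].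

(* free-dim(T) >= d.+1 is by definition the negation of free-dim(T) <= d;
   free-dim(T) >= 0 is no condition. *)
Definition free_dim_ge (R : realType) (T : topologicalType) (n : nat) : Prop :=
  if n is d.+1 then ~ free_dim_le R T d else True.

(* Main.v *)
Require Import Defs.
From HB Require Import structures.
From mathcomp Require Import finmap all_boot all_order all_algebra.
From mathcomp Require Import all_classical all_reals all_analysis.
From mathcomp Require Import lra.

Set Implicit Arguments.
Unset Strict Implicit.
Unset Printing Implicit Defensive.

Import Order.TTheory GRing.Theory Num.Theory.
Import numFieldNormedType.Exports.

(** Suppose that [free-dim K <= d], witnessed by a cofinal family [F], a
    constant [M] and labels [chi].  The contradiction comes from counting
    pairwise separated points.  A cover [U] splits two points when no member of
    [U] contains both; if a finite cover [D] refines covers that together split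
    every pair of points of a finite set, then [D] has at least as many members
    as that set has points.

    An open cover of a factor [K_i] pulls back to the product, where some
    member of [F] refines it, so it receives a natural number as label: the
    value of [chi] there.  For a nonmetrizable factor one label [c_i] is so
    frequent that for every [k] there are [k] covers with label [c_i] and [k]
    points that these covers split pairwise (nonmetrizable_scattered).  In the
    infinite factor a single cover splits [N] prescribed points
    (infinite_scattered); let [e] be its label.  Splitting points in the factors
    splits the [k ^ d * N] points of the grid (prod_scattered_card), so
    [k ^ d * N <= M * (k * (c_1 + ... + c_d) + e) ^ d].  Taking [k = e + 1]
    gives [N <= M * (c_1 + ... + c_d + 1) ^ d], which is absurd because [N] is
    arbitrary.

    The nonmetrizable factor is treated with chains.  A chain is a sequence of
    triples [(f, x, y)] with [f x = 0] and [f y = 1] in which no earlier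
    function distinguishes the points [x] and [y] of a later triple.  If for
    each label the chains of functions whose cover has this label are bounded
    in length, then the maximal chains, one for each label, involve only
    countably many functions; by Urysohn's lemma these functions separate the
    points, and a compact space with such a sequence is metrizable
    (metrizable_of_separating_seq).  Hence some label has arbitrarily long
    chains.  From a long chain, a Ramsey-type halving extracts the desired
    points (long_chain_scattered). *)

Local Open Scope classical_set_scope.
Local Open Scope ring_scope.

(** * Compact spaces with a separating sequence of functions *)

(** The truncation by [1 / (n + 1)] makes all but finitely many of the functions
    irrelevant at a given scale, which is what relates this distance to the
    topology; it also keeps the supremum finite for unbounded functions. *)
Definition gauge_dist (R : realType) (T : Type) (f : nat -> T -> R)
    (x y : T) : R :=
  sup (range (fun n => Num.min `|f n x - f n y| n.+1%:R^-1)).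

Section gauge_dist_theory.
Context {R : realType} {T : Type} (f : nat -> T -> R).
Implicit Types x y z : T.

Let term x y n := Num.min `|f n x - f n y| n.+1%:R^-1.

Lemma gauge_dist_ubound x y n : term x y n <= gauge_dist f x y.
Proof.
apply: ub_le_sup; last by exists n.
exists 1 => _ [m _ <-]; rewrite ge_min; apply/orP; right.
by rewrite invf_le1// ler1n.
Qed.

Lemma gauge_dist_le x y (e : R) :
  (forall n, term x y n <= e) -> gauge_dist f x y <= e.
Proof.
move=> le_e; apply: ge_sup => [|_ [n _ <-]]; last exact: le_e.
by exists (term x y 0%N); exists 0%N.
Qed.

Lemma gauge_distxx x : gauge_dist f x x = 0.
Proof.
have t0 n : term x x n = 0.
  by rewrite /term subrr normr0 min_l.
apply/eqP; rewrite eq_le; apply/andP; split.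
  by apply: gauge_dist_le => n; rewrite -/(term x x n) t0.
by rewrite -(t0 0%N) gauge_dist_ubound.
Qed.

Lemma gauge_dist_sym x y : gauge_dist f x y = gauge_dist f y x.
Proof.
by rewrite /gauge_dist; do 2!f_equal; apply/funext => n; rewrite distrC.
Qed.

Lemma gauge_dist_triangle y x z :
  gauge_dist f x z <= gauge_dist f x y + gauge_dist f y z.
Proof.
apply: gauge_dist_le => n.
apply: le_trans (lerD (gauge_dist_ubound x y n) (gauge_dist_ubound y z n)).
have := ler_distD (f n y) (f n x) (f n z); rewrite /term.
have : 0 < n.+1%:R^-1 :> R by rewrite invr_gt0.
(* Truncation at a positive constant is subadditive on nonnegative reals. *)
move: (n.+1%:R^-1) `|f n x - f n y| (normr_ge0 (f n x - f n y))
  `|f n y - f n z| (normr_ge0 (f n y - f n z)) `|f n x - f n z|.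
move=> c a a0 b b0 s c0 sab.
by rewrite /Num.min; do 3!case: ltP => ?; lra.
Qed.

Lemma gauge_dist_eq0 x y : gauge_dist f x y = 0 -> forall n, f n x = f n y.
Proof.
move=> d0 n; apply/eqP; rewrite -subr_eq0 -normr_le0.
have := gauge_dist_ubound x y n; rewrite d0 /term ge_min => /orP[//|].
by rewrite leNgt invr_gt0 ltr0Sn.
Qed.

End gauge_dist_theory.

(** Beyond an index [N] the truncation makes every term small, and the finitely
    many continuous functions before [N] vary little near [x]. *)
Lemma near_gauge_dist (R : realType) (T : topologicalType) (f : nat -> T -> R)
    (x : T) (e : R) :
  (forall n, continuous (f n)) -> 0 < e ->
  \forall y \near x, gauge_dist f x y < e.
Proof.
move=> cf e0; have e20 : 0 < e / 2 by rewrite divr_gt0.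
have [N _ ltN] := near_infty_natSinv_lt (PosNum e20).
have near_lt : \forall y \near x, forall i : 'I_N, `|f i x - f i y| < e / 2.
  apply: filter_forall => i.
  by have /cvgrPdist_lt/(_ _ e20) := cf i x.
apply: filterS near_lt => y lt_y.
apply: (@le_lt_trans _ _ (e / 2)); last by lra.
apply: gauge_dist_le => n; rewrite ge_min.
have [nN|Nn] := ltnP n N; first by rewrite (ltW (lt_y (Ordinal nN))).
by rewrite (ltW (ltN n Nn)) orbT.
Qed.

Lemma continuous_bij_compact (S T : topologicalType) (f : S -> T) (g : T -> S) :
  compact [set: S] -> hausdorff_space T -> continuous f ->
  cancel f g -> cancel g f -> continuous g.
Proof.
move=> cS hT cf fK gK; apply/continuous_closedP => A clA.
have -> : g @^-1` A = f @` A.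
  apply/seteqP; split=> [y Ay|_ [x Ax <-]]; first by exists (g y).
  by rewrite /preimage/= fK.
apply: compact_closed => //; apply: continuous_compact.
  exact: continuous_subspaceT.
exact: subclosed_compact cS _.
Qed.

(** The identity from the compact topology to that of [gauge_dist] is continuous,
    and a metric topology is Hausdorff, so the two topologies agree. *)
Lemma metrizable_of_separating_seq (R : realType) (T : topologicalType)
    (f : nat -> T -> R) :
  compact [set: T] -> (forall n, continuous (f n)) ->
  (forall x y, (forall n, f n x = f n y) -> x = y) ->
  metrizable R T.
Proof.
move=> cT cf sep.
pose M := isMetric.Build R T (gauge_distxx f)
  (fun x y d0 => sep x y (gauge_dist_eq0 d0))
  (gauge_dist_sym f) (gauge_dist_triangle f).
pose X : metricType R := HB.pack (Choice.sort T) M.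
have cid : continuous (id : T -> X).
  move=> x; apply/metricType_numDomainType.cvgrPdist_lt => e e0.
  exact: near_gauge_dist.
exists X, id, id; split => //.
by apply: (@continuous_bij_compact T X id id) => //; exact: metric_hausdorff.
Qed.

(** * Covers that split points *)

Definition splits (T : Type) (U : set (set T)) (a b : T) : Prop :=
  forall u, U u -> ~ (u a /\ u b).

(** The points of [p] cannot share members of a common refinement of [L], so a
    cover that refines all of [L] has at least [size p] members. *)
Definition scattered (T : topologicalType) (L : seq (set (set T))) (p : seq T) :
    Prop :=
  uniq p /\ {in p &, forall a b, a != b -> exists2 U, U \in L & splits U a b}.

Lemma splits_sym (T : Type) (U : set (set T)) a b : splits U a b -> splits U b a.
Proof. by move=> sab u /sab nab [ub ua]; apply: nab. Qed.

Lemma cover_splits_neq (T : topologicalType) (U : set (set T)) a b :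
  open_cover U -> splits U a b -> a != b.
Proof.
move=> [_ coverU] sab; apply/eqP => ab; subst b.
have [u Uu ua] : (\bigcup_(A in U) A) a by rewrite coverU.
exact: (sab u Uu).
Qed.

(** * Points split by the covers attached to a long chain *)

Section level_covers.
Context {R : realType} {T : topologicalType}.
Implicit Type f : T -> R.

(** Three pieces instead of two, so that the values [0] and [1] are each split
    from the value [1/2]: whatever [f b] is, [b] is split from a zero of [f] or
    from a point where [f] is [1]. *)
Definition level_cover f : set (set T) :=
  [set [set x | f x < 1/2]; [set x | 0 < f x /\ f x < 1]; [set x | 1/2 < f x]].

Lemma level_cover_open f : continuous f -> open_cover (level_cover f).
Proof.
move=> cf; have oc (A : set R) : open A -> open (f @^-1` A).
  by move=> oA; apply: open_comp.
split=> [A [[->|->]|->]|].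
- exact: (oc _ (@open_lt R _)).
- exact: (openI (oc _ (@open_gt R _)) (oc _ (@open_lt R _))).
- exact: (oc _ (@open_gt R _)).
apply/seteqP; split=> // x _.
have [lt|gt|eq] := ltrgtP (f x) (1/2).
- by exists [set x | f x < 1/2]; [left; left|].
- by exists [set x | 1/2 < f x]; [right|].
- exists [set x | 0 < f x /\ f x < 1]; first by left; right.
  by rewrite /= eq; split; lra.
Qed.

Lemma level_cover_splits1 f a b : f a = 1 -> f b <= 1/2 -> splits (level_cover f) a b.
Proof. by move=> fa fb u [[->|->]|->] /=; rewrite fa => -[? ?]; lra. Qed.

Lemma level_cover_splits0 f a b : f a = 0 -> 1/2 <= f b -> splits (level_cover f) a b.
Proof. by move=> fa fb u [[->|->]|->] /=; rewrite fa => -[? ?]; lra. Qed.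

End level_covers.

Section chains.
Context {R : realType} {T : topologicalType} (G : set (T -> R)).
Local Notation link := ((T -> R) * (T * T))%type.

(** A triple [(f, (x, y))] comes after the functions that do not distinguish
    [x] from [y]; the earliest triple is the head. *)
Fixpoint chain (s : seq link) : Prop :=
  if s is t :: s' then
    [/\ G t.1, t.1 t.2.1 = 0, t.1 t.2.2 = 1,
        {in s', forall t', t.1 t'.2.1 = t.1 t'.2.2} & chain s']
  else True.

Lemma chain_filter (a : pred link) s : chain s -> chain ([seq t0 <- s | a t0]).
Proof.
elim: s => //= t s IHs [Gt t0 t1 eqt /IHs cs]; case: ifP => // _.
by split=> // t'; rewrite mem_filter => /andP[_ /eqt].
Qed.

Lemma chain_rcons s (f : T -> R) x y :
  chain s -> G f -> f x = 0 -> f y = 1 -> {in s, forall t, t.1 x = t.1 y} ->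
  chain (rcons s (f, (x, y))).
Proof.
move=> cs Gf fx fy; elim: s cs => [_ _|t s IHs [Gt t0 t1 eqt cs] eqs] //=.
split=> //; last by apply: IHs => // t' t's; apply: eqs; rewrite inE t's orbT.
move=> t'; rewrite mem_rcons inE => /predU1P[->/=|/eqt//].
by apply: eqs; rewrite mem_head.
Qed.

Lemma chain_gen s : chain s -> {in s, forall t, G t.1}.
Proof.
elim: s => //= t s IHs [Gt _ _ _ /IHs cs] t'.
by rewrite inE => /predU1P[->//|/cs].
Qed.

Definition chain_point (s : seq link) (a : T) : Prop :=
  exists2 t, t \in s & a = t.2.1 \/ a = t.2.2.

(** The head function [f] takes a single value at the two points of each later
    triple.  Keep whichever half of the tail has this value at most [1/2] or
    above [1/2].  In the first case the head point where [f] is [1], in the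
    second the head point where [f] is [0], is split by the cover of [f] from
    all the points of the triples kept; these are handled by induction. *)
Lemma long_chain_scattered (k : nat) (s : seq link) :
  G `<=` [set f | continuous f] -> chain s -> (2 ^ k <= size s)%N ->
  exists (F : seq (T -> R)) (p : seq T),
    [/\ size F = k, size p = k, {in F, forall f, G f},
        {in p, forall a, chain_point s a}
      & scattered [seq level_cover f | f <- F] p].
Proof.
move=> cG; elim: k s => [|k IHk] s cs.
  by move=> _; exists [::], [::].
case: s cs => [|t s]; first by rewrite leqn0 expn_eq0.
rewrite expnS mul2n -addnn /=.
move=> [Gt t0 t1 eqt cs] ks.
suff grow (a : pred link) (z : T) : (2 ^ k <= size ([seq t0 <- s | a t0]))%N ->
    z = t.2.1 \/ z = t.2.2 ->
    (forall q, chain_point ([seq t0 <- s | a t0]) q -> splits (level_cover t.1) z q) ->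
    exists (F : seq (T -> R)) (p : seq T),
    [/\ size F = k.+1, size p = k.+1, {in F, forall f, G f},
        {in p, forall a, chain_point (t :: s) a}
      & scattered [seq level_cover f | f <- F] p].
  pose a (t' : link) := t.1 t'.2.1 <= 1/2.
  have [ka|ka] := leqP (2 ^ k) (size ([seq t0 <- s | a t0])).
    apply: (grow a t.2.2) => //; first by right.
    move=> q [t']; rewrite mem_filter => /andP[at' t's] qt'.
    apply: level_cover_splits1 => //.
    by case: qt' => ->; rewrite -?(eqt t').
  apply: (grow (predC a) t.2.1) => //; last first.
  - move=> q [t']; rewrite mem_filter /= -ltNge => /andP[at' t's] qt'.
    apply: level_cover_splits0 => //.
    by case: qt' => ->; rewrite -?(eqt t')// ltW.
  - by left.
  have szs : (size [seq x <- s | a x] + size [seq x <- s | predC a x] = size s)%N.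
    by rewrite !size_filter; exact: count_predC.
  (* The first half is too short by at least one, which pays for the head. *)
  rewrite -(leq_add2l (size [seq x <- s | a x]).+1) !addSn szs -addSn.
  by apply: leq_trans ks; rewrite leq_add2r.
move=> ka zt split_z.
have [F [p [szF szp GF pP [up sp]]]] := IHk _ (chain_filter a cs) ka.
exists (t.1 :: F), (z :: p); split=> /=; rewrite ?szF ?szp//.
- by move=> f; rewrite inE => /predU1P[->//|/GF].
- move=> b; rewrite inE => /predU1P[->|/pP[t' t's bt']].
    by exists t; rewrite ?mem_head.
  by exists t' => //; move: t's; rewrite mem_filter inE => /andP[_ ->]; rewrite orbT.
have sz b : b \in p -> splits (level_cover t.1) z b by move=> /pP/split_z.
have hd : level_cover t.1 \in [seq level_cover f | f <- t.1 :: F] by rewrite mem_head.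
split.
  rewrite /= up andbT; apply/negP => /sz zz.
  by have := cover_splits_neq (level_cover_open (cG _ Gt)) zz; rewrite eqxx.
move=> b c; rewrite !inE => /predU1P[->|bp] /predU1P[->|cp] neq.
- by rewrite eqxx in neq.
- by exists (level_cover t.1) => //; exact: sz.
- by exists (level_cover t.1) => //; apply: splits_sym; exact: sz.
- by have [U UF sU] := sp _ _ bp cp neq; exists U => //; rewrite inE UF orbT.
Qed.

Lemma long_or_maximal_chain :
  (forall k, exists2 s, chain s & size s = k) \/
  exists2 s, chain s & forall t, ~ chain (rcons s t).
Proof.
have [?|nomax] := pselect (exists2 s, chain s & forall t, ~ chain (rcons s t)).
  by right.
left; elim=> [|k [s cs szs]]; first by exists [::].
apply: contrapT => noext; apply: nomax; exists s => // t ct.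
by apply: noext; exists (rcons s t); rewrite ?size_rcons ?szs.
Qed.

End chains.

(** Only countably many labels are available, so bounded chains for every label
    would leave a countable separating family of functions. *)
Lemma nonmetrizable_scattered (R : realType) (T : topologicalType)
    (lab : set (set T) -> nat) :
  compact [set: T] -> hausdorff_space T -> ~ metrizable R T ->
  exists n, forall k, exists (L : seq (set (set T))) (p : seq T),
    [/\ size L = k, size p = k,
        {in L, forall U, open_cover U /\ lab U = n} & scattered L p].
Proof.
move=> cT hT nmT.
pose G n := [set f : T -> R | continuous f /\ lab (level_cover f) = n].
have [[n long]|nolong] :=
    pselect (exists n, forall k, exists2 s, chain (G n) s & size s = k).
  exists n => k; have [s cs szs] := long (2 ^ k)%N.
  have cG : G n `<=` [set f | continuous f] by move=> f [].
  have [F [p [szF szp GF _ sp]]] := long_chain_scattered cG cs (eq_leq (esym szs)).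
  exists [seq level_cover f | f <- F], p; split=> //; first by rewrite size_map.
  by move=> _ /mapP[f /GF[cf labf] ->]; split=> //; exact: level_cover_open.
exfalso; apply: nmT.
have /choice[S maxS] n : exists s,
    chain (G n) s /\ forall t, ~ chain (G n) (rcons s t).
  have [long|[s cs ms]] := long_or_maximal_chain (G n); last by exists s.
  by exfalso; apply: nolong; exists n.
(* An enumeration of all the functions that occur in the maximal chains. *)
pose g (m : nat) : T -> R := if unpickle m is Some (n, i)
  then nth (cst 0) (map fst (S n)) i else cst 0.
have gP n t : t \in S n -> exists m, g m = t.1.
  move=> tS; exists (pickle (n, index t.1 (map fst (S n)))).
  by rewrite /g pickleK nth_index// map_f.
apply: (@metrizable_of_separating_seq R T g) => // [m|x y gxy].
  rewrite /g; case: unpickle => [[n i]|]; last exact: cst_continuous.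
  have [im|im] := ltnP i (size (map fst (S n))); last first.
    by rewrite nth_default//; exact: cst_continuous.
  have /mapP[t tS ->] := mem_nth (cst 0) im.
  by have [cS _] := maxS n; have [] := chain_gen cS tS.
apply: contrapT => /eqP neq.
(* A Urysohn function for [x] and [y] would prolong the maximal chain of its
   own label. *)
have /normal_separatorP-/(_ R) sepT := compact_normal hT cT.
have cl1 := accessible_closed_set1 (hausdorff_accessible hT).
have : [set x] `&` [set y] = set0.
  by apply/seteqP; split=> // z [/= -> xy]; rewrite xy eqxx in neq.
move=> /(sepT _ _ (cl1 x) (cl1 y))/(@uniform_separatorP _ R)[f [cf _ fx fy]].
pose n := lab (level_cover f).
have [cS] := maxS n; apply; apply: (@chain_rcons R T (G n) (S n) f x y) => //.
- by apply: (fx (f x)); exists x.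
- by apply: (fy (f y)); exists y.
- by move=> t /gP[m <-].
Qed.

(** * Infinite spaces and products *)

(** The complements of the finite sets [q \ {a}], for [a] in a finite set [q]:
    each of them contains only one point of [q]. *)
Lemma infinite_scattered (T : topologicalType) (k : nat) :
  accessible_space T -> infinite_set [set: T] ->
  exists (U : set (set T)) (p : seq T),
    [/\ size p = k, open_cover U & scattered [:: U] p].
Proof.
(* One point more than required, so that the cover has a member even if
   [k = 0]. *)
move=> /accessible_finite_set_closed clT /infinite_set_fset-/(_ k.+1)[B _ kB].
pose q : seq T := enum_fset B.
pose U := [set u | exists2 a, a \in q & u = ~` [set b | b \in q /\ b != a]].
exists U, (take k q); split.
- by rewrite size_take; case: ltngtP kB => //.
- split=> [_ [a _ ->]|].
    apply: closed_openC; apply: clT; apply: (@sub_finite_set _ _ [set` q]) => //.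
    by move=> b [].
  apply/seteqP; split=> // x _.
  have [xq|xq] := boolP (x \in q).
    exists (~` [set b | b \in q /\ b != x]); first by exists x.
    by move=> [_]; rewrite eqxx.
  have q0 : nth x q 0 \in q by apply: mem_nth; apply: leq_trans kB.
  exists (~` [set b | b \in q /\ b != nth x q 0]); first by exists (nth x q 0).
  by move=> [xq' _]; rewrite xq' in xq.
- split; first by apply: take_uniq; exact: fset_uniq.
  move=> a b /mem_take aq /mem_take bq ab; exists U; first by rewrite mem_head.
  move=> _ [c cq ->] [/= Na Nb].
  have [ac|ac] := eqVneq a c; last by apply: Na.
  by apply: Nb; split=> //; rewrite -ac eq_sym.
Qed.

Definition cylinder_cover (I : Type) (K : I -> topologicalType) (i : I)
    (U : set (set (K i))) : set (set (prod_topology K)) :=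
  [set @proj I K i @^-1` u | u in U].

Lemma cylinder_cover_open (I : eqType) (K : I -> topologicalType) (i : I)
    (U : set (set (K i))) :
  open_cover U -> open_cover (cylinder_cover U).
Proof.
move=> [oU cU]; split=> [_ [u Uu <-]|].
  by apply: open_comp; [move=> x _; exact: proj_continuous|exact: oU].
apply/seteqP; split=> // x _.
have [u Uu ux] : (\bigcup_(A in U) A) (x i) by rewrite cU.
by exists (proj i @^-1` u); [exists u|].
Qed.

(** Two different points of the grid [prod_i p i] differ in some coordinate, where
    a cover splits them; hence a member of [D] contains at most one point of the
    grid. *)
Lemma prod_scattered_card (I : finType) (K : I -> topologicalType)
    (L : forall i, seq (set (set (K i)))) (p : forall i, seq (K i))
    (D : set (set (prod_topology K))) :
  (forall i, scattered (L i) (p i)) ->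
  finite_set D -> \bigcup_(A in D) A = setT ->
  (forall i U, U \in L i -> refines D (cylinder_cover U)) ->
  (\prod_i size (p i) <= #|` fset_set D|)%N.
Proof.
move=> scat finD coverD refD.
pose J i := 'I_(size (p i)).
pose pt (h : {dffun forall i, J i}) : prod_topology K :=
  fun i => tnth (in_tuple (p i)) (h i).
have /choice[A AP] z : exists A0, D A0 /\ A0 z.
  by have [B DB Bz] : (\bigcup_(B in D) B) z; [rewrite coverD|exists B].
have inj : injective (A \o pt).
  move=> h h' /= eqA; apply/ffunP => i; apply: contrapT => /eqP neq.
  have [up sp] := scat i.
  have [|U UL sU] := sp (pt h i) (pt h' i) (mem_tnth _ _) (mem_tnth _ _).
    by apply: contra neq => /eqP/((elimT (tuple_uniqP (in_tuple (p i))) up) _ _)->.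
  have [DA Ah] := AP (pt h); have [_ Ah'] := AP (pt h').
  have [_ [u Uu <-] sub] := refD i U UL _ DA.
  apply: (sU u Uu); split; first exact: (sub _ Ah).
  by apply: (sub (pt h')); rewrite eqA.
have -> : (\prod_i size (p i) = #|{dffun forall i, J i}|)%N.
  rewrite card_dep_ffun foldrE big_map big_enum.
  by apply: eq_bigr => i _; rewrite card_ord.
rewrite -(size_image (A \o pt)).
apply: uniq_leq_size; first by rewrite map_inj_uniq// enum_uniq.
move=> _ /mapP[h _ ->]; rewrite in_fset_set// inE; by have [] := AP (pt h).
Qed.

(** * The lower bound for products *)

Theorem theorem3p1 (R : realType) (d : nat) (hd : (1 <= d)%N)
  (K : 'I_d.+1 -> topologicalType)
  (K_compact : forall i, compact [set: K i])
  (K_hausdorff : forall i, hausdorff_space (K i))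
  (K_nonmetrizable : forall i : 'I_d.+1, (i < d)%N -> ~ metrizable R (K i))
  (K_infinite : infinite_set [set: K ord_max]) :
  free_dim_ge R (prod_topology K) d.+1.
Proof.
move=> [F [M [chi [FFCC cofinal M0 Fbound]]]].
have /choice[r rP] U : exists C, open_cover U -> F C /\ refines C U.
  have [oU|noU] := pselect (open_cover U); last by exists set0.
  by have [C FC rC] := cofinal U oU; exists C.
pose lab i (U : set (set (K i))) := chi (r (cylinder_cover U)).
have /choice[c cP] (i : 'I_d.+1) : exists n, (i < d)%N ->
    forall k, exists (L : seq (set (set (K i)))) (p : seq (K i)),
    [/\ size L = k, size p = k,
        {in L, forall U, open_cover U /\ lab i U = n} & scattered L p].
  have [ilt|ige] := boolP (i < d)%N; last by exists 0%N.
  have [n nP] := nonmetrizable_scattered (lab i) (K_compact i) (K_hausdorff i)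
    (K_nonmetrizable i ilt).
  by exists n.
pose s := (\sum_i c i).+1.
suff bounded N : N%:R <= M * (s ^ d)%:R.
  have := archi_boundP (mulr_ge0 (ltW M0) (ler0n R (s ^ d))).
  by rewrite ltNge bounded.
have acc := hausdorff_accessible (K_hausdorff ord_max).
have [U0 [p0 [szp0 oU0 scat0]]] := infinite_scattered N acc K_infinite.
(* With this [k], the label of [U0] is at most [k * 1], so that every factor
   contributes at most [k] times a constant to the sum of the labels. *)
pose k := (lab _ U0).+1.
have fam (i : 'I_d.+1) : exists Lp : seq (set (set (K i))) * seq (K i),
    [/\ scattered Lp.1 Lp.2, {in Lp.1, forall U, open_cover U},
        size Lp.2 = if (i < d)%N then k else N, (0 < size Lp.1)%N
      & (\sum_(U <- Lp.1) lab i U <= k * if (i < d)%N then c i else 1)%N].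
  have [ilt|ige] := boolP (i < d)%N.
    have [L [p [szL szp Llab scat]]] := cP i ilt k.
    exists (L, p); split=> //=; [by move=> U /Llab[]|by rewrite szL|].
    rewrite (eq_big_seq (fun=> c i)) => [|U /Llab[]//].
    by rewrite big_const_seq count_predT szL iter_addn_0 mulnC.
  have -> : i = ord_max.
    by apply/val_inj/eqP; rewrite eqn_leq -ltnS ltn_ord leqNgt ige.
  exists ([:: U0], p0); split=> //=.
  - by move=> U; rewrite inE => /eqP->.
  - by rewrite big_seq1 muln1.
pose L i := (projT1 (cid (fam i))).1; pose p i := (projT1 (cid (fam i))).2.
have scat i : scattered (L i) (p i) by rewrite /L /p; case: cid => ? [].
have oL i : {in L i, forall U, open_cover U} by rewrite /L; case: cid => ? [].
have szp i : size (p i) = if (i < d)%N then k else N.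
  by rewrite /p; case: cid => ? [].
have L0 i : (0 < size (L i))%N by rewrite /L; case: cid => ? [].
have labL i : (\sum_(U <- L i) lab i U <= k * if (i < d)%N then c i else 1)%N.
  by rewrite /L; case: cid => ? [].
pose Cs := [seq r (cylinder_cover U) | i <- enum 'I_d.+1, U <- L i].
have CsL i U : U \in L i -> r (cylinder_cover U) \in Cs.
  by move=> UL; apply/allpairsPdep; exists i, U; rewrite mem_enum.
have Cs0 : (0 < size Cs)%N.
  case: (L ord0) (L0 ord0) (@CsL ord0) => // U ? _ /(_ _ (mem_head _ _)).
  by rewrite lt0n size_eq0; apply: contraTneq => ->.
have FCs j : F (tnth (in_tuple Cs) j).
  have /allpairsPdep[i [U [_ UL ->]]] := mem_tnth j (in_tuple Cs).
  exact: (rP _ (cylinder_cover_open (oL _ _ UL))).1.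
have [D [[finD _ coverD] refD]] := Fbound _ _ Cs0 FCs.
rewrite -(big_tnth _ _ Cs predT chi) => ubD.
have lbD : (k ^ d * N <= #|` fset_set D|)%N.
  have := prod_scattered_card scat finD coverD.
  rewrite big_ord_recr /= szp ltnn; under eq_bigr do rewrite szp /= ltn_ord.
  rewrite prod_nat_const card_ord; apply=> i U UL A DA.
  have /(tnthP (in_tuple Cs))[j CsE] := CsL _ _ UL.
  have [B CB AB] := refD j A DA.
  have [_ refr] := rP _ (cylinder_cover_open (oL _ _ UL)).
  have [|u Uu Bu] := refr B; first by rewrite CsE.
  by exists u => //; exact: subset_trans Bu.
have sumCs : (\sum_(C <- Cs) chi C <= k * s)%N.
  rewrite big_allpairs_dep big_enum (eq_bigl xpredT)//=.
  apply: (@leq_trans (\sum_(i < d.+1) k * if (i < d)%N then c i else 1)%N).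
    by apply: leq_sum => i _; exact: labL.
  rewrite -big_distrr leq_mul2l /s big_ord_recr /= ltnn addn1 ltnS.
  rewrite [leqRHS]big_ord_recr /=; apply: leq_trans (leq_addr _ _).
  by apply: leq_sum => i _; rewrite ltn_ord.
have kd0 : 0 < (k ^ d)%:R :> R by rewrite ltr0n expn_gt0.
rewrite -(ler_pM2l kd0) -natrM.
apply: (@le_trans _ _ (#|` fset_set D|)%:R); first by rewrite ler_nat.
apply: (le_trans ubD); rewrite mulrCA -natrM -expnMn.
by rewrite ler_pM2l// ler_nat leq_exp2r.
Qed.
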